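(* Let $p\in[1,\infty)$, $p\ne2$. There exists a lattice $\mathcal L$ such that the martingale difference spaces $D_I=\Delta_I L^2$, $I\in\mathcal L$, do not form a strong unconditional basis in $H^p=H^p(\mathcal L)$.
   Context: Setting. $\mathbb X$ is $\mathbb R$ or a (finite or infinite) subinterval of $\mathbb R$; $|\cdot|$ is Lebesgue measure. A lattice $\mathcal L$ on $\mathbb X$ is a collection of non-trivial bounded intervals (of the form $[a,b)$) in $\mathbb X$ that is a union of generations $\mathcal L_k$, $k\in\mathbb Z$, where each $\mathcal L_k$ is a collection of disjoint intervals covering $\mathbb X$, and each $I\in\mathcal L_k$ is a finite disjoint union of intervals $J\in\mathcal L_{k+1}$ (possibly just one, $J=I$). The rank $\mathrm{rk}(I)$ is the largest $k$ with $I\in\mathcal L_k$; if $\mathrm{rk}(I)=k$, the children of $I$ are the $J\in\mathcal L_{k+1}$ with $J\subset I$ (hence $J\subsetneq I$). (If $I\in\mathcal L_k$ for all large $k$, then $I$ has no children, $\Delta_I:=0$, and $I$ is omitted from the system $\{D_I\}$.) Put $\mathbb E_I f=\bigl(|I|^{-1}\int_I f\,dx\bigr)\mathbf 1_I$, $\Delta_I f=\sum_{J\in\mathrm{child}(I)}\mathbb E_J f-\mathbb E_I f$, and $D_I=\Delta_I L^2$ (functions supported on $I$, constant on each child of $I$, with integral $0$). $\mathfrak A^{0}_{-\infty}$ is the collection of all intervals $\bigcup_{k\in\mathbb Z}I_k$ with $I_k\in\mathcal L_k$, $I_k\subset I_{k-1}$, and $\mathfrak A^{0,\mathrm{fin}}_{-\infty}=\{I\in\mathfrak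 A^0_{-\infty}:|I|<\infty\}$. All functions are assumed Borel and constant on every interval of the form $\bigcap_k I_k$, $I_k\in\mathcal L_k$, $I_k\subset I_{k-1}$. $H^p$ is the space of $f\in L^p(\mathbb X)$ with $\mathbb E_I f=0$ for all $I\in\mathfrak A^{0,\mathrm{fin}}_{-\infty}$ and $Sf:=\bigl(\sum_{I\in\mathcal L}|\Delta_I f|^2\bigr)^{1/2}\in L^p$, with norm $\|Sf\|_p$. Strong unconditional basis. A Banach space $Y$ of sequences $\{c_j\}_{j\in\mathcal J}$ of complex numbers ($\mathcal J$ countable) is called ideal if for any factors $|\alpha_j|\le1$ and any $\{c_j\}\in Y$ one has $\{\alpha_jc_j\}\in Y$ and $\|\{\alpha_jc_j\}\|_Y\le\|\{c_j\}\|_Y$. A system of nontrivial subspaces $\mathcal E_j$, $j\in\mathcal J$, of a Banach space $X$ is a strong unconditional basis if (i) the linear span of $\{\mathcal E_j\}_{j\in\mathcal J}$ is dense in $X$; (ii) there exist an ideal Banach space $Y$ of sequences $\{c_j\}_{j\in\mathcal J}$ and a constant $A>0$ such that for every family $x_j\in\mathcal E_j$, $j\in\mathcal J$, with finitely many non-zero elements, $\frac1A\bigl\|\sum_j x_j\bigr\|_X\le\bigl\|\{\|x_j\|_X\}_{j\in\mathcal J}\bigr\|_Y\le A\bigl\|\sum_j x_j\bigr\|_X$. *)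

(* Defs.v *)
From HB Require Import structures.
From mathcomp Require Import all_boot all_order all_algebra.
From mathcomp Require Import complex.
From mathcomp Require Import all_classical all_reals all_analysis.

Set Implicit Arguments.
Unset Strict Implicit.
Unset Printing Implicit Defensive.

Import Order.TTheory GRing.Theory Num.Theory.
Import numFieldNormedType.Exports.

Local Open Scope classical_set_scope.
Local Open Scope ring_scope.
Local Open Scope complex_scope.

(* Functions are complex valued and defined on the whole line; only their
   values on X matter.  Functions that agree almost everywhere are not
   identified: H^p is a set of functions with a seminorm. *)

Section Lattices.
Context {R : realType}.
Implicit Types (X I J : set R).

(* The intervals on which lattices exist: since [X] is a union of intervals
   [a, b[, it cannot contain its right endpoint. *)
Definition base_interval X : Prop :=
  [/\ is_interval X, X !=set0 & forall x, X x -> exists2 y, X y & x < y].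

Record lattice X := Lattice {
  generation :> int -> set (set R);
  generation_itv : forall k I, generation k I ->
    exists a b : R, a < b /\ I = `[a, b[%classic;
  generation_disjoint : forall k, trivIset (generation k) id;
  generation_cover : forall k, \bigcup_(I in generation k) I = X;
  generation_refine : forall k I, generation k I ->
    exists F : set (set R), [/\ finite_set F, F `<=` generation (k + 1)
                              & I = \bigcup_(J in F) J] }.

Section LatticeNotions.
Context {X : set R} (L : lattice X).

Definition members : set (set R) := \bigcup_k L k.

Definition has_rank I (k : int) : Prop :=
  L k I /\ forall m : int, k < m -> ~ L m I.

Definition children I : set (set R) :=
  [set J | exists k, [/\ has_rank I k, L (k + 1) J & J `<=` I]].

(* An interval without children is one of unbounded rank; the differences
   [mdiff] vanish there and it does not index a subspace. *)
Definition branching : set (set R) :=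
  [set I | members I /\ children I !=set0].

(* The class called $\mathfrak A^0_{-\infty}$, and its finite-length part. *)
Definition ancestral : set (set R) :=
  [set A | exists I : int -> set R,
    [/\ forall k, L k (I k), forall k, I k `<=` I (k - 1)
      & A = \bigcup_k I k]].

Definition ancestral_fin : set (set R) :=
  [set A | ancestral A /\ (lebesgue_measure A < +oo)%E].

Definition admissible (f : R -> R[i]) : Prop :=
  [/\ measurable_fun X (fun x => complex.Re (f x)),
      measurable_fun X (fun x => complex.Im (f x))
    & forall I : int -> set R,
        (forall k, L k (I k)) -> (forall k, I k `<=` I (k - 1)) ->
        forall x y, (\bigcap_k I k) x -> (\bigcap_k I k) y -> f x = f y].

Definition integralC I (f : R -> R[i]) : R[i] :=
  Rintegral lebesgue_measure I (fun x => complex.Re (f x)) +i*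
  Rintegral lebesgue_measure I (fun x => complex.Im (f x)).

Definition averaging I (f : R -> R[i]) : R -> R[i] :=
  fun x => ((fine (lebesgue_measure I))^-1)%:C * integralC I f * (\1_I x)%:C.

Definition mdiff I (f : R -> R[i]) : R -> R[i] :=
  if `[< children I !=set0 >]
  then \sum_(J \in children I) averaging J f - averaging I f
  else 0.

Definition Lp_space (p : R) : set (R -> R[i]) :=
  [set f | admissible f /\
    ('N[lebesgue_measure]_(p%:E) [(fun x => (Normc.normc (f x))%:E) \_ X]
       < +oo)%E].

Definition square_function (f : R -> R[i]) : R -> \bar R :=
  fun x => ((\esum_(I in members) ((Normc.normc (mdiff I f x)) ^+ 2)%:E)
              `^ 2^-1)%E.

Definition Hspace (p : R) : set (R -> R[i]^o) :=
  [set f | [/\ Lp_space p f, forall I, ancestral_fin I -> averaging I f = 0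
    & ('N[lebesgue_measure]_(p%:E) [square_function f] < +oo)%E]].

Definition Hnorm (p : R) (f : R -> R[i]^o) : R :=
  fine ('N[lebesgue_measure]_(p%:E) [square_function f])%E.

Definition mdiff_space (I : branching) : set (R -> R[i]^o) :=
  mdiff (val I) @` Lp_space 2.

End LatticeNotions.
End Lattices.

Section StrongUnconditionalBases.
Context {R : realType} {J : choiceType}.

(* A Banach space of sequences indexed by [J] is a Banach space [Y] together
   with the linear injection [coef] sending a vector to its sequence. *)
Definition ideal_space (Y : completeNormedModType R[i])
    (coef : {linear Y -> (J -> R[i]^o)}) : Prop :=
  injective coef /\
  forall (alpha : J -> R[i]) (y : Y), (forall j, `|alpha j| <= 1) ->
    exists2 z : Y, coef z = (fun j => alpha j * coef y j) & `|z| <= `|y|.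

Definition finite_family {V : lmodType R[i]} (E : J -> set V) (x : J -> V) :=
  (forall j, E j (x j)) /\ finite_set [set j | x j != 0].

(* The normed space is the set [H] with the (semi)norm [nrm], and the [E j]
   are linear subspaces of it, so that their linear span is the set of the
   finite sums of elements of the [E j].  Any [coef y] is determined by [y] and
   conversely, so the [y] below is the sequence of norms seen in [Y]. *)
Definition strong_unconditional_basis {V : lmodType R[i]} (H : set V)
    (nrm : V -> R) (E : J -> set V) : Prop :=
  (forall f, H f -> forall e : R, 0 < e ->
     exists2 x : J -> V, finite_family E x &
       nrm (f - \sum_(j \in [set: J]) x j) < e) /\
  (exists (Y : completeNormedModType R[i])
      (coef : {linear Y -> (J -> R[i]^o)}) (A : R),
    [/\ ideal_space coef, 0 < A &
      forall x : J -> V, finite_family E x ->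
        exists y : Y,
          [/\ coef y = (fun j => (nrm (x j))%:C),
              (A^-1 * nrm (\sum_(j \in [set: J]) x j))%:C <= `|y| &
              `|y| <= (A * nrm (\sum_(j \in [set: J]) x j))%:C]]).

End StrongUnconditionalBases.

(* Main.v *)
Require Import Defs.
From mathcomp Require Import all_boot all_order all_algebra.
From mathcomp Require Import complex.
From mathcomp Require Import all_classical all_reals all_analysis.
From mathcomp Require Import measurable_realfun.
From mathcomp Require Import ring lra.

(** On a cell with many equal children, a martingale difference of prescribed
    [L^p] norm can either have constant modulus or be concentrated on two
    children.  In the lattice below every cell of generation [k] has [2^(k+1)]
    children.  Let [h_k] be the sum of such differences over all cells of
    generation [k] contained in a fixed interval.  For the flat choice the square
    function of [h_0 + ... + h_(n-1)] is the constant [sqrt n]; for the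
    concentrated choice [|h_k|^p] takes the values [0] and [2^k], so that only the
    last non-zero term counts and the square function [S] satisfies
    [S^p ~ sum_k |h_k|^p].  The norms are of the order of [n^(1/2)] and [n^(1/p)],
    although all the summands have the same norms in both cases.  In a strong
    unconditional basis these two quantities would be comparable. *)

Set Implicit Arguments.
Unset Strict Implicit.
Unset Printing Implicit Defensive.

Import Order.TTheory GRing.Theory Num.Theory.
Import numFieldNormedType.Exports.

Local Open Scope classical_set_scope.
Local Open Scope ring_scope.

(** * Lattices of dyadic cells *)

Section WhitneyPartition.
Context {R : realType}.

(** An integer [n] satisfies [n <= x / m] iff [n * m <= x], and the latter only tests the floor of
    [x]. This gives the nesting of the dyadic grids below. *)
Lemma floor_divn (m : nat) (x y : R) :
  (0 < m)%N -> Num.floor x = Num.floor y ->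
  Num.floor (x / m%:R) = Num.floor (y / m%:R).
Proof.
move=> m0 xy; apply/eqP; rewrite eq_le.
have H (u v : R) : Num.floor u = Num.floor v ->
    Num.floor (u / m%:R) <= Num.floor (v / m%:R).
  move=> uv; have m0' : 0 < m%:R :> R by rewrite ltr0n.
  rewrite floor_ge_int ler_pdivlMr// -[m%:R]/(m%:~R) -intrM -floor_ge_int -uv.
  by rewrite floor_ge_int intrM -ler_pdivlMr// floor_le.
by rewrite !H.
Qed.

(* [root x] holds the endpoints of the interval of the partition containing [x]. *)
Definition partition_map (X : set R) (root : R -> R * R) : Prop :=
  forall x, X x -> (root x).1 <= x < (root x).2 /\
    forall y, (root x).1 <= y < (root x).2 -> X y /\ root y = root x.

(* The intervals are the maximal dyadic subintervals of [X]; the dyadic grid is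
   placed at the left endpoint of [X] when it belongs to [X]. *)
Lemma exists_partition_map (X : set R) : base_interval X ->
  exists root : R -> R * R, partition_map X root.
Proof.
case=> Xitv [x0 Xx0] Xmax.
(* The origin [c] of the grid is the minimum of [X] if there is one; otherwise it is an arbitrary
   point of [X], and every point of [X] has a point of [X] to its left. *)
have [c Xc] : exists c, forall x, X x -> c <= x /\ X c \/ exists2 y, X y & y < x.
  have [[c [Xc cmin]]|nomin] := pselect (exists c, X c /\ forall x, X x -> c <= x).
    by exists c => x Xx; left; split=> //; exact: cmin.
  exists x0 => x Xx; right; apply: contrapT => nex; apply: nomin; exists x; split=> //.
  by move=> y Xy; rewrite leNgt; apply/negP => yx; apply: nex; exists y.
pose fl n x := Num.floor ((x - c) * 2 ^+ n).
pose lo n x := c + (fl n x)%:~R / 2 ^+ n.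
pose hi n x := c + (fl n x + 1)%:~R / 2 ^+ n.
have p2 n : 0 < 2 ^+ n :> R by rewrite exprn_gt0.
have in_cell n x y : (lo n x <= y < hi n x) = (fl n y == fl n x).
  rewrite /lo /hi -lerBrDl -ltrBlDl ler_pdivrMr// ltr_pdivlMr// -floor_ge_int.
  by rewrite -floor_lt_int ltzD1 -eq_le eq_sym.
have fl_le m n x y : (m <= n)%N -> fl n x = fl n y -> fl m x = fl m y.
  move=> mn; have E z : fl m z = Num.floor ((z - c) * 2 ^+ n / (2 ^ (n - m))%:R).
    have -> : 2 ^+ n = 2 ^+ (n - m) * 2 ^+ m :> R by rewrite -exprD subnK.
    rewrite natrX.
    by congr Num.floor; field; rewrite expf_neq0.
  by rewrite !E; apply: floor_divn; rewrite expn_gt0.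
pose P x n := `[< forall y, lo n x <= y < hi n x -> X y >].
(* There is room in [X] to the right of [x]. On the left, either there is room too, or the grid
   starts at the endpoint [c] and no cell of a point of [X] crosses it. So a short enough cell
   fits. *)
have exP x : X x -> exists n, P x n.
  move=> Xx; have [y Xy xy] := Xmax _ Xx.
  have small e : 0 < e -> exists n, 2^-1 ^+ n < e :> R.
    move=> e0; have := @cvg_expr R 2^-1; rewrite gtr0_norm ?invr_gt0//.
    rewrite invf_lt1// ltr1n => /(_ isT) /cvgrPdist_lt /(_ _ e0) [n _ /(_ n (leqnn n))] /=.
    by rewrite sub0r normrN gtr0_norm ?exprn_gt0// => H; exists n.
  have width n : hi n x = lo n x + 2^-1 ^+ n.
    by rewrite /hi /lo intrD mulrDl addrA mul1r exprVn.
  have xin n : lo n x <= x < hi n x by rewrite in_cell.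
  case: (Xc x Xx) => [[cx Xcc]|[z Xz zx]].
    have [n n_small] := small (y - x) ltac:(by rewrite subr_gt0).
    exists n; apply/asboolP => t /andP[t1 t2].
    apply: (Xitv c y) => //; apply/andP; split; last first.
      by move: (xin n) => /andP[]; rewrite width in t2 *; lra.
    apply: le_trans t1; rewrite lerDl divr_ge0//.
    by rewrite ler0z floor_ge_int mulr_ge0 ?subr_ge0// ltW.
  have e0 : 0 < Num.min (y - x) (x - z) by rewrite lt_min !subr_gt0 xy.
  have [n] := small _ e0; rewrite lt_min => /andP[n1 n2].
  exists n; apply/asboolP => t /andP[t1 t2].
  apply: (Xitv z y) => //; move: (xin n) => /andP[].
  by rewrite width in t2 *; move=> *; apply/andP; split; lra.
(* The least admissible [n] gives the largest dyadic cell around [x] inside [X]. The default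
   [(0, 0)] is never taken on [X]. *)
pose root x := if pselect (exists n, P x n) is left e
               then (lo (ex_minn e) x, hi (ex_minn e) x) else (0, 0).
exists root => x Xx; rewrite /root; case: pselect => [ex|/(_ (exP _ Xx))//].
case: ex_minnP => n Pn nmin /=; split; first by rewrite in_cell.
move=> y yin; have Xy : X y by move/asboolP: Pn; exact.
split=> //; case: pselect => [ey|/(_ (exP _ Xy))//].
have fly : fl n y = fl n x by apply/eqP; rewrite -in_cell.
(* Up to scale [n] the cells of [x] and [y] coincide, so the two minimal scales are equal. *)
have eqP' m : (m <= n)%N -> P y m = P x m /\ (lo m y, hi m y) = (lo m x, hi m x).
  by move=> mn; rewrite /P /lo /hi (fl_le m n y x).
case: ex_minnP => m Pm mmin.
have mn : (m <= n)%N by apply: mmin; rewrite (eqP' n _).1.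
have nm : (n <= m)%N by apply: nmin; rewrite -(eqP' m mn).1.
by rewrite (eqP' m mn).2; have /eqP -> : m == n by rewrite eqn_leq mn.
Qed.

End WhitneyPartition.

Section Cells.
Context {R : realType} (X : set R) (root : R -> R * R).
Local Notation mu := (@lebesgue_measure R).

Definition length (x : R) : R := (root x).2 - (root x).1.

Definition index (D : nat) (x : R) : nat :=
  Num.truncn ((x - (root x).1) / length x * 2 ^+ D).

Definition node (D : nat) (x : R) (j : nat) : R :=
  (root x).1 + length x * (j%:R / 2 ^+ D).

(** Described through [index] instead of endpoints, so that nesting and equality of cells become
    arithmetic of indices; [piece_itv] recovers the interval. *)
Definition piece (D : nat) (x : R) (j : nat) : set R :=
  [set y | [/\ X y, root y = root x & index D y = j]].

Definition cell (D : nat) (x : R) : set R := piece D x (index D x).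

Hypothesis rootP : partition_map X root.

Lemma length_gt0 x : X x -> 0 < length x.
Proof.
by move=> Xx; have [/andP[x1 x2] _] := rootP Xx; rewrite subr_gt0 (le_lt_trans x1).
Qed.

Lemma scaled_itv D x : X x ->
  0 <= (x - (root x).1) / length x * 2 ^+ D < 2 ^+ D.
Proof.
move=> Xx; have l0 := length_gt0 Xx; have [/andP[x1 x2] _] := rootP Xx.
apply/andP; split.
  by apply: mulr_ge0; [apply: divr_ge0; [rewrite subr_ge0|exact: ltW]|exact: exprn_ge0].
by rewrite gtr_pMl ?exprn_gt0// ltr_pdivrMr// mul1r ltrD2r.
Qed.

Lemma index_lt D x : X x -> (index D x < 2 ^ D)%N.
Proof.
move=> Xx; have /andP[x1 x2] := scaled_itv D Xx.
by rewrite /index truncn_lt_nat// natrX.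
Qed.

(** Passing to a coarser depth drops the last [e] binary digits: both sides have the same natural
    lower bounds. *)
Lemma index_divn D e x : X x -> index D x = (index (D + e) x %/ 2 ^ e)%N.
Proof.
move=> Xx; have /andP[x1 _] := scaled_itv D Xx.
have /andP[y1 _] := scaled_itv (D + e) Xx.
have H n : (n <= index D x)%N = (n <= index (D + e) x %/ 2 ^ e)%N.
  rewrite leq_divRL ?expn_gt0// /index !truncn_ge_nat// natrM natrX exprD mulrA.
  by rewrite ler_pM2r// exprn_gt0.
by apply/eqP; rewrite eqn_leq -H leqnn H leqnn.
Qed.

Lemma index_coarse D D' x y : X x -> X y -> (D <= D')%N ->
  index D' x = index D' y -> index D x = index D y.
Proof.
by move=> Xx Xy DD' H; rewrite !(index_divn D (D' - D))// subnKC// H.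
Qed.

Lemma node_lt D x i j : X x -> (node D x i < node D x j) = (i < j)%N.
Proof.
move=> Xx; rewrite /node ltrD2l ltr_pM2l ?length_gt0// ltr_pM2r ?ltr_nat//.
Qed.

Lemma piece_itv D x j : X x -> (j < 2 ^ D)%N ->
  piece D x j = `[node D x j, node D x j.+1[%classic.
Proof.
move=> Xx jD; have l0 := length_gt0 Xx; have [_ rx] := rootP Xx.
have p0 : 0 < 2 ^+ D :> R by rewrite exprn_gt0.
have node_ge y i : (node D x i <= y) = (i%:R <= (y - (root x).1) / length x * 2 ^+ D).
  by rewrite /node -lerBrDl mulrC -ler_pdivlMr// ler_pdivrMr.
have node_gt y i : (y < node D x i) = ((y - (root x).1) / length x * 2 ^+ D < i%:R).
  by rewrite !real_ltNge ?num_real// node_ge.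
apply/seteqP; split => y /=.
  case=> Xy ry <-; have /andP[s0 _] := scaled_itv D Xy.
  rewrite in_itv /= node_ge node_gt /length -ry -!/(length y).
  by have := truncn_itv s0; rewrite /index.
rewrite in_itv /= node_ge node_gt => /andP[y1 y2].
have /rx[Xy ry] : (root x).1 <= y < (root x).2.
  apply/andP; split.
    have : 0 <= (y - (root x).1) / length x * 2 ^+ D by apply: le_trans y1.
    by rewrite pmulr_lge0// pmulr_lge0 ?invr_gt0// subr_ge0.
  have : (y - (root x).1) / length x * 2 ^+ D < 2 ^+ D.
    by rewrite (lt_le_trans y2)// -natrX ler_nat.
  by rewrite gtr_pMl// ltr_pdivrMr// mul1r ltrD2r.
split=> //; rewrite /index /length ry -/(length x).
by apply: truncn_def; rewrite y1.
Qed.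

Lemma piece_empty D x j : (2 ^ D <= j)%N -> piece D x j = set0.
Proof.
move=> jD; apply/seteqP; split=> // y [Xy _ yj].
by have := index_lt D Xy; rewrite yj ltnNge jD.
Qed.

Lemma measurable_piece D x j : X x -> measurable (piece D x j).
Proof.
move=> Xx; have [jD|jD] := ltnP j (2 ^ D).
  by rewrite piece_itv//; exact: measurable_itv.
by rewrite piece_empty.
Qed.

Lemma measure_piece D x j : X x -> (j < 2 ^ D)%N ->
  mu (piece D x j) = (length x / 2 ^+ D)%:E.
Proof.
move=> Xx jD; rewrite piece_itv// lebesgue_measure_itv/= lte_fin node_lt// ltnSn.
rewrite -EFinB; congr EFin; rewrite /node -natr1.
by field; rewrite expf_neq0.
Qed.

Lemma cell_mem D x : X x -> cell D x x.
Proof. by []. Qed.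

Lemma cell_eq D x y : cell D x y -> cell D y = cell D x.
Proof. by case=> Xy ry iy; rewrite /cell /piece ry iy. Qed.

Lemma cell_subset D D' x : X x -> (D <= D')%N -> cell D' x `<=` cell D x.
Proof. by move=> Xx DD' y [Xy ry iy]; split=> //; exact: index_coarse iy. Qed.

(** Equal cells lie in the same initial interval, where the measure [length x / 2 ^+ D] determines
    [D]. This recovers the generation of a cell from the bare set. *)
Lemma cell_level D D' x y : X x -> X y -> cell D x = cell D' y -> D = D'.
Proof.
move=> Xx Xy E.
have [_ ry _] : cell D' y x by rewrite -E; exact: cell_mem.
have := measure_piece Xx (index_lt D Xx).
rewrite -/(cell D x) E measure_piece//; last exact: index_lt.
have l0 := length_gt0 Xx.
rewrite /length -ry -/(length x) => -[] /(mulfI (lt0r_neq0 l0)) /invr_inj.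
rewrite -!natrX => /eqP; rewrite eqr_nat eqn_exp2l// => /eqP; exact: esym.
Qed.

Lemma finite_cells D D' x : finite_set (cell D' @` cell D x).
Proof.
apply: (@sub_finite_set _ _ (piece D' x @` `I_(2 ^ D'))); last first.
  by apply: finite_image; exact: finite_II.
move=> _ [y [Xy ry _] <-]; exists (index D' y); first exact: index_lt.
by rewrite /cell /piece ry.
Qed.

Lemma measurable_cell D x : X x -> measurable (cell D x).
Proof. exact: measurable_piece. Qed.

(* Generation [k + 1] cuts each cell of generation [k] in [2 ^ k.+1] equal parts;
   the generations of negative index repeat the initial partition. *)
Definition depth (n : nat) : nat := \sum_(i < n) i.+1.

Lemma depthS n : depth n.+1 = (depth n + n.+1)%N.
Proof. by rewrite /depth big_ord_recr. Qed.

Lemma depth_le m n : (m <= n)%N -> (depth m <= depth n)%N.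
Proof.
move=> mn; rewrite -(subnKC mn); elim: (n - m)%N => [|k IH]; first by rewrite addn0.
by rewrite addnS depthS (leq_trans IH)// leq_addr.
Qed.

Lemma depth_lt m n : (m < n)%N -> (depth m < depth n)%N.
Proof.
by move=> mn; apply: leq_trans (depth_le mn); rewrite depthS addnS ltnS leq_addr.
Qed.

Lemma depth_inj : injective depth.
Proof.
by move=> m n E; case: (ltngtP m n) => // /depth_lt; rewrite E ltnn.
Qed.

Definition level (k : int) : nat := if k is Posz n then depth n else 0%N.

Lemma level_le (k l : int) : k <= l -> (level k <= level l)%N.
Proof. by case: k l => [m|m] [n|n] //= /depth_le. Qed.

Definition cells (k : int) : set (set R) := cell (level k) @` X.

Lemma cells_itv k I : cells k I -> exists a b : R, a < b /\ I = `[a, b[%classic.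
Proof.
move=> [x Xx <-]; exists (node (level k) x (index (level k) x)).
exists (node (level k) x (index (level k) x).+1).
by rewrite node_lt// -piece_itv//; exact: index_lt.
Qed.

Lemma cells_disjoint k : trivIset (cells k) id.
Proof.
move=> _ _ [x Xx <-] [y Xy <-] [z [/cell_eq <- /cell_eq <-]]; reflexivity.
Qed.

Lemma cells_cover k : \bigcup_(I in cells k) I = X.
Proof.
apply/seteqP; split => [y [_ [x Xx <-] []//]|x Xx].
by exists (cell (level k) x); [exists x|exact: cell_mem].
Qed.

Lemma cells_refine k I : cells k I ->
  exists F : set (set R), [/\ finite_set F, F `<=` cells (k + 1)
                            & I = \bigcup_(J in F) J].
Proof.
move=> [x Xx <-]; exists (cell (level (k + 1)) @` cell (level k) x); split.
- exact: finite_cells.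
- by move=> _ [y [Xy _ _] <-]; exists y.
- apply/seteqP; split=> [y xy|y [_ [z xz <-]] zy].
    by exists (cell (level (k + 1)) y); [exists y|apply: cell_mem; case: xy].
  rewrite -(cell_eq xz); apply: cell_subset zy; first by case: xz.
  by apply: level_le; rewrite lerDl.
Qed.

Definition cell_lattice : lattice X :=
  Lattice cells_itv cells_disjoint cells_cover cells_refine.

End Cells.

(** Write [j = q * n + r]: a condition on the quotient selects whole blocks. Below, a block is the
    set of children of one cell. *)
Lemma sum_blocks (V : nmodType) (m n : nat) (P : pred nat) (F : nat -> V) :
  (0 < n)%N ->
  \sum_(j < m * n | P (j %/ n)%N) F j =
  \sum_(q < m | P q) \sum_(r < n) F (q * n + r)%N.
Proof.
move=> n0; rewrite [LHS]big_mkcond [RHS]big_mkcond/=.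
rewrite -(big_mkord xpredT (fun j => if P (j %/ n)%N then F j else 0)).
rewrite -(big_mkord xpredT (fun q => if P q then \sum_(r < n) F (q * n + r)%N else 0)).
rewrite big_nat_mul; apply: eq_bigr => q _.
rewrite -{1}[(q * n)%N]add0n big_addn mulSn addnK big_mkord.
under eq_bigr => r _ do rewrite addnC divnMDl// divn_small// addn0.
by case: (P q) => //; rewrite big1.
Qed.

(** * Step functions on one interval of the initial partition *)

Section Steps.
Context {R : realType} (X : set R) (root : R -> R * R).
Hypothesis rootP : partition_map X root.
Context (o : R).
Hypothesis Xo : X o.
Local Notation mu := (@lebesgue_measure R).
Local Notation length := (length root).
Local Notation index := (index root).
Local Notation piece := (piece X root).
Local Notation cell := (cell X root).

(** The support is kept in the single initial interval of [o], so that integrals are finite even if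
    the partition is infinite. *)
Definition step (D : nat) (Phi : nat -> R) (y : R) : R :=
  if `[< X y /\ root y = root o >] then Phi (index D y) else 0.

Lemma step_in D Phi y : X y -> root y = root o -> step D Phi y = Phi (index D y).
Proof. by move=> Xy ry; rewrite /step asboolT. Qed.

Lemma step_out D Phi y : ~ (X y /\ root y = root o) -> step D Phi y = 0.
Proof. by move=> H; rewrite /step asboolF. Qed.

Lemma step_sum D Phi y :
  step D Phi y = \sum_(j < 2 ^ D) Phi j * \1_(piece D o j) y.
Proof.
have [[Xy ry]|H] := pselect (X y /\ root y = root o).
  rewrite step_in// (bigD1 (Ordinal (index_lt rootP D Xy)))//= big1 ?addr0.
    by rewrite indicE mem_set ?mulr1.
  move=> j jy; rewrite indicE memNset ?mulr0// => -[_ _ yj].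
  by move/eqP: jy; apply; apply: val_inj.
rewrite step_out// big1// => j _; rewrite indicE memNset ?mulr0// => -[Xy ry _].
by apply: H.
Qed.

Lemma measurable_step A D Phi : measurable_fun A (step D Phi).
Proof.
rewrite (_ : step D Phi = fun y => \sum_(j < 2 ^ D) Phi j * \1_(piece D o j) y).
  apply: measurable_sum => j; apply: measurable_funM => //.
  by apply: measurable_indic; exact: measurable_piece.
by apply/funext => y; exact: step_sum.
Qed.

(** The domain is a disjoint union of pieces of equal measure; a cell of smaller depth is of this
    form. *)
Lemma integral_step D Phi (P : pred nat) :
  (\int[mu]_(y in [set y | [/\ X y, root y = root o & P (index D y)]])
     (step D Phi y)%:E =
   (length o / 2 ^+ D * \sum_(j < 2 ^ D | P j) Phi j)%:E)%E.
Proof.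
have -> : [set y | [/\ X y, root y = root o & P (index D y)]] =
    \big[setU/set0]_(j <- [seq j <- index_iota 0 (2 ^ D) | P j]) piece D o j.
  apply/seteqP; split => y; rewrite -bigcup_seq /=.
    case=> Xy ry Py; exists (index D y) => //=.
    by rewrite mem_filter Py mem_index_iota (index_lt rootP).
  by case=> j /=; rewrite mem_filter => /andP[Pj _] [Xy ry iy]; rewrite iy.
rewrite integral_bigsetU_EFin/=; first last.
- by apply/measurable_EFinP; exact: measurable_step.
- by move=> i j _ _ [y [[_ _ <-] [_ _ <-]]].
- by rewrite filter_uniq// iota_uniq.
- by move=> j; exact: measurable_piece.
rewrite big_filter mulr_sumr -sumEFin big_mkord; apply: eq_bigr => j Pj.
rewrite (eq_integral (cst (Phi j)%:E)); last first.
  by move=> y /set_mem[Xy ry jy]; rewrite step_in// jy.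
rewrite integral_cst/=; last exact: measurable_piece.
by rewrite (measure_piece rootP)// -EFinM mulrC.
Qed.

Lemma integral_stepT D Phi :
  (\int[mu]_y (step D Phi y)%:E =
   (length o / 2 ^+ D * \sum_(j < 2 ^ D) Phi j)%:E)%E.
Proof.
rewrite -(integral_step D Phi xpredT) [RHS]integral_mkcond; apply: eq_integral => y _.
rewrite patchE; case: ifPn => // /negP yo; rewrite step_out// => -[Xy ry].
by apply: yo; rewrite inE.
Qed.

Lemma integrable_step A D Phi : measurable A ->
  mu.-integrable A (EFin \o step D Phi).
Proof.
move=> mA; apply: (@integrableS _ _ _ _ setT) => //; apply/integrableP; split.
  by apply/measurable_EFinP; exact: measurable_step.
rewrite (_ : (\int[mu]_x _)%E = (\int[mu]_x (step D (fun j => `|Phi j|) x)%:E)%E).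
  by rewrite integral_stepT ltry.
by apply: eq_integral => y _ /=; rewrite /step; case: asboolP => _; rewrite ?normr0.
Qed.

Lemma step_cell D D' Phi x y : X x -> (D <= D')%N -> cell D' x y ->
  step D Phi y = step D Phi x.
Proof.
move=> Xx DD' xy; have [Xy ry iy] := xy.
have [rx|nrx] := pselect (root x = root o).
  by rewrite !step_in// ?ry// (index_coarse rootP Xy Xx DD' iy).
by rewrite !step_out// => -[_] //; rewrite ry.
Qed.

(* [step (depth k.+1) Phi] has mean zero on every cell of generation [k]. *)
Definition balanced (k : nat) (Phi : nat -> R) : Prop :=
  forall q, (q < 2 ^ depth k)%N -> \sum_(r < 2 ^ k.+1) Phi (q * 2 ^ k.+1 + r)%N = 0.

Definition mean (A : set R) (g : R -> R) : R :=
  (fine (mu A))^-1 * \int[mu]_(y in A) g y.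

(** For [k < m] the function is constant on the cell. Otherwise the cell is a union of cells of
    generation [k], and the integral over each of them vanishes by balance. *)
Lemma mean_step k m Phi x : balanced k Phi -> X x ->
  mean (cell (depth m) x) (step (depth k.+1) Phi) =
  if (k < m)%N then step (depth k.+1) Phi x else 0.
Proof.
move=> bal Xx; have mC := measurable_cell rootP (depth m) Xx.
rewrite /mean; case: ltnP => km.
  rewrite (_ : \int[mu]_(y in _) _ y =
      \int[mu]_(y in cell (depth m) x) (cst (step (depth k.+1) Phi x) y)); last first.
    apply: eq_Rintegral => y /set_mem xy.
    by rewrite (step_cell _ _ _ xy)//; exact: depth_le.
  rewrite Rintegral_cst//= (measure_piece rootP)//=; last exact: (index_lt rootP).
  have l0 := length_gt0 rootP Xx.
  by rewrite mulrCA mulVf ?mulr1// mulf_neq0 ?lt0r_neq0// invr_gt0 exprn_gt0.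
suff -> : \int[mu]_(y in cell (depth m) x) step (depth k.+1) Phi y = 0 by rewrite mulr0.
have [rx|nrx] := pselect (root x = root o); last first.
  rewrite /Rintegral integral0_eq// => y [Xy ry _].
  by rewrite step_out// => -[_]; rewrite ry.
have mk : (depth m <= depth k)%N by exact: depth_le.
pose P j := (j %/ 2 ^ (depth k.+1 - depth m) == index (depth m) x)%N.
have -> : cell (depth m) x =
    [set y | [/\ X y, root y = root o & P (index (depth k.+1) y)]].
  have H y : X y -> P (index (depth k.+1) y) = (index (depth m) y == index (depth m) x).
    move=> Xy; rewrite /P (index_divn rootP (depth m) (depth k.+1 - depth m) Xy).
    by rewrite subnKC//; apply: depth_le; exact: leqW.
  apply/seteqP; split => y [Xy ry iy]; split=> //; rewrite ?ry ?rx//.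
    by rewrite H// iy.
  by move: iy; rewrite H// => /eqP.
rewrite /Rintegral integral_step/= depthS expnD.
(* Whether a piece lies in the cell depends only on its ancestor at [depth k], so the sum runs over
   complete blocks of siblings. *)
pose Q q := (q %/ 2 ^ (depth k - depth m) == index (depth m) x)%N.
rewrite (eq_bigl (fun j : 'I_(2 ^ depth k * 2 ^ k.+1) => Q (j %/ 2 ^ k.+1)%N)); last first.
  by move=> j; rewrite /P /Q depthS addnC -addnBA// expnD divnMA.
rewrite (sum_blocks _ Q Phi) ?expn_gt0// big1 ?mulr0// => q _.
by apply: bal.
Qed.

End Steps.

(** * Martingale differences and square functions of step functions *)

Lemma fsbig_fct (I : choiceType) (T : Type) (V : nmodType) (D : set I)
    (F : I -> T -> V) y :
  finite_set D -> (\sum_(i \in D) F i) y = \sum_(i \in D) F i y.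
Proof. by move=> fD; rewrite !fsbig_finite// fct_sumE. Qed.

Lemma averaging_real (R : realType) (I : set R) (g : R -> R) :
  averaging I (fun y => (g y)%:C%C) = fun y => (mean I g * \1_I y)%:C%C.
Proof.
apply/funext => y; rewrite /averaging /integralC /= /mean.
rewrite [X in (_ +i* X)%C](_ : _ = 0); last by rewrite /Rintegral integral0.
by rewrite complexr0 !rmorphM.
Qed.

Section Differences.
Context {R : realType} (X : set R) (root : R -> R * R).
Hypothesis rootP : partition_map X root.
Context (o : R).
Hypothesis Xo : X o.
Local Notation mu := (@lebesgue_measure R).
Local Notation length := (length root).
Local Notation index := (index root).
Local Notation piece := (piece X root).
Local Notation cell := (cell X root).
Local Notation step := (step X root o).
Local Notation L := (cell_lattice rootP).

(** Generations of negative index repeat generation [0], so natural indices suffice. *)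
Lemma members_cell I : members L I <-> exists m x, X x /\ I = cell (depth m) x.
Proof.
split=> [[[m|m] _ [x Xx <-]]|[m [x [Xx ->]]]].
- by exists m, x.
- by exists 0%N, x; rewrite /depth big_ord0.
- by exists (Posz m) => //; exists x.
Qed.

Lemma rank_cell m x : X x -> has_rank L (cell (depth m) x) (Posz m).
Proof.
move=> Xx; split; first by exists x.
move=> [l|l] //= ml [y Xy /(cell_level rootP Xy Xx)] /= /depth_inj E.
by move: ml; rewrite E ltxx.
Qed.

Lemma children_cell m x : X x ->
  children L (cell (depth m) x) = cell (depth m.+1) @` cell (depth m) x.
Proof.
move=> Xx; apply/seteqP; split => [J [k [[Lk kmax] LJ JI]]|_ [y xy <-]].
  have [Lm mmax] := rank_cell m Xx.
  have km : k = Posz m.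
    by case: (ltgtP k (Posz m)) => // [/kmax|/mmax].
  move: LJ; rewrite km -PoszD addn1 => -[y Xy /= E].
  by exists y => //; apply: JI; rewrite -E; exact: cell_mem.
exists (Posz m); split; first exact: rank_cell.
  by rewrite -PoszD addn1; exists y => //; case: xy.
by rewrite -(cell_eq xy); apply: (cell_subset rootP); [case: xy|exact: depth_le].
Qed.

Lemma branching_cell m x : X x -> branching L (cell (depth m) x).
Proof.
move=> Xx; split; first by apply/members_cell; exists m, x.
by rewrite children_cell//; exists (cell (depth m.+1) x); exists x => //; exact: cell_mem.
Qed.

(** Among the children only the one containing [y] contributes at [y]. *)
Lemma mdiff_real (g : R -> R) m x y : X x ->
  mdiff L (cell (depth m) x) (fun y => (g y)%:C%C) y =
  (if `[< cell (depth m) x y >]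
   then mean (cell (depth m.+1) y) g - mean (cell (depth m) y) g else 0)%:C%C.
Proof.
move=> Xx; have [_ ch0] := branching_cell m Xx.
rewrite /mdiff asboolT// children_cell// averaging_real.
rewrite -[LHS]/((\sum_(J \in _) averaging J _) y - _) fsbig_fct; last exact: finite_cells.
under eq_fsbigr do rewrite averaging_real.
case: asboolP => xy.
  rewrite -(fsbig_widen [set cell (depth m.+1) y]); first last.
  - move=> _ [[z xz <-] zy] /=; rewrite indicE memNset ?mulr0//.
    by move=> /cell_eq zy'; apply: zy; rewrite /= zy'.
  - by move=> _ ->; exists y.
  rewrite fsbig_set1 !indicE mem_set ?(mem_set xy); last first.
    by apply: cell_mem; case: xy.
  by rewrite !mulr1 -rmorphB (cell_eq xy).
rewrite fsbig1 ?sub0r; last first.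
  move=> _ [z xz <-]; rewrite indicE memNset ?mulr0// => zy; apply: xy.
  rewrite -(cell_eq xz); apply: (cell_subset rootP) zy; first by case: xz.
  exact: depth_le.
by rewrite indicE memNset// mulr0 oppr0.
Qed.

Lemma mean_sum (A : set R) (D : nat -> nat) n (g : nat -> nat -> R) : measurable A ->
  mean A (fun y => \sum_(k < n) step (D k) (g k) y) =
  \sum_(k < n) mean A (step (D k) (g k)).
Proof.
move=> mA; rewrite /mean -mulr_sumr; congr (_ * _).
elim: n => [|n IH].
  under eq_Rintegral do rewrite big_ord0.
  by rewrite big_ord0 /Rintegral integral0.
under eq_Rintegral do rewrite big_ord_recr/=.
have st k := integrable_step rootP Xo (D k) (g k) mA.
rewrite RintegralD//= ?IH ?big_ord_recr//.
have -> : EFin \o (fun y => \sum_(k < n) step (D k) (g k) y) =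
    fun y => (\sum_(k <- index_enum 'I_n) (EFin \o step (D k) (g k)) y)%E.
  by apply/funext => y /=; rewrite sumEFin.
by apply: integrable_sum => // k _; exact: st.
Qed.

(** By [mean_step], the [k]-th summand enters the mean over a cell of generation [m] iff [k < m];
    subtracting consecutive generations leaves [k = m] alone. *)
Lemma mdiff_steps n (Phi : nat -> nat -> R) m x y :
  (forall k, (k < n)%N -> balanced k (Phi k)) -> X x ->
  mdiff L (cell (depth m) x)
    (fun y => (\sum_(k < n) step (depth k.+1) (Phi k) y)%:C%C) y =
  (if `[< cell (depth m) x y >] && (m < n)%N
   then step (depth m.+1) (Phi m) y else 0)%:C%C.
Proof.
move=> bal Xx; rewrite mdiff_real//; case: asboolP => //= xy; congr (_%:C)%C.
have Xy : X y by case: xy.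
rewrite !(mean_sum (fun k => depth k.+1) n Phi (measurable_cell rootP _ Xy)).
under eq_bigr => k _ do rewrite (mean_step rootP Xo _ (bal k (ltn_ord k)) Xy).
under [X in _ - X]eq_bigr => k _ do rewrite (mean_step rootP Xo _ (bal k (ltn_ord k)) Xy).
rewrite -sumrB; case: ifPn => mn; last first.
  rewrite big1// => k _; rewrite ltnS -leqNgt in mn *.
  have km : (k < m)%N by exact: leq_trans mn.
  by rewrite (ltnW km) km subrr.
rewrite (bigD1 (Ordinal mn))//= ltnSn ltnn subr0 big1 ?addr0// => k km.
have -> : (k < m.+1)%N = (k < m)%N.
  by rewrite ltnS leq_eqVlt; case: eqP => // E; move: km; rewrite -val_eqE /= E eqxx.
by rewrite subrr.
Qed.

Lemma square_function_steps n (Phi : nat -> nat -> R) y :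
  (forall k, (k < n)%N -> balanced k (Phi k)) ->
  square_function L (fun y => (\sum_(k < n) step (depth k.+1) (Phi k) y)%:C%C) y =
  ((\sum_(k < n) step (depth k.+1) (Phi k) y ^+ 2) `^ 2^-1)%:E.
Proof.
move=> bal; rewrite /square_function -poweR_EFin; congr (_ `^ _)%E.
have sq_mdiff m x : X x ->
    Normc.normc (mdiff L (cell (depth m) x)
      (fun y => (\sum_(k < n) step (depth k.+1) (Phi k) y)%:C%C) y) ^+ 2 =
    if `[< cell (depth m) x y >] && (m < n)%N
    then step (depth m.+1) (Phi m) y ^+ 2 else 0.
  move=> Xx; rewrite mdiff_steps//= expr0n /= addr0 sqrtr_sqr.
  by case: ifP => _; rewrite ?normr0 ?expr0n// real_normK ?num_real.
have [Xy|nXy] := pselect (X y); last first.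
  rewrite esum1 ?big1// => [k _|I /members_cell[m [x [Xx ->]]]].
    by rewrite step_out ?expr0n// => -[].
  by rewrite sq_mdiff// asboolF// => -[].
(* The cells of generation less than [n] containing [y], one for each generation; all other
   differences vanish at [y]. *)
pose S : set (set R) := (fun k => cell (depth k) y) @` `I_n.
have Sinj : set_inj `I_n (fun k => cell (depth k) y).
  by move=> i j _ _ /(cell_level rootP Xy Xy) /depth_inj.
transitivity (\esum_(I in S) ((Normc.normc (mdiff L I
    (fun y => (\sum_(k < n) step (depth k.+1) (Phi k) y)%:C%C) y)) ^+ 2)%:E)%E.
  rewrite (esumID S); last by move=> I _; rewrite lee_fin sqr_ge0.
  rewrite (_ : members L `&` S = S); last first.
    apply/seteqP; split=> [I []//|_ [k kn <-]]; split; last by exists k.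
    by apply/members_cell; exists k, y.
  rewrite [X in (_ + X)%E]esum1 ?adde0// => I [/members_cell[m [x [Xx ->]]] nS].
  rewrite sq_mdiff//; case: asboolP => //= xy; case: ifPn => // mn.
  by case: nS; exists m => //; exact: cell_eq.
rewrite /S esum_image// esum_fset//; last by move=> k _; rewrite lee_fin sqr_ge0.
rewrite -fsbig_ord -sumEFin; apply: eq_bigr => k _.
by rewrite sq_mdiff// asboolT//= ltn_ord.
Qed.


End Differences.

(** * Sums of powers *)

Section PowerSums.
Context {R : realType}.
Implicit Types (p a : R) (n : nat).

Lemma sqr_powR p a : (a ^+ 2) `^ (p / 2) = `|a| `^ p.
Proof.
rewrite -real_normK ?num_real// -powR_mulrn// -powRrM; congr (_ `^ _).
by rewrite mulrCA divff ?mulr1// pnatr_eq0.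
Qed.

(** At most one term survives on either side. This is the situation of a single atom at a given
    point. *)
Lemma powR_sum_sqr1 p n (a : 'I_n -> R) : p != 0 ->
  (forall i j, a i != 0 -> a j != 0 -> i = j) ->
  (\sum_(i < n) a i ^+ 2) `^ (p / 2) = \sum_(i < n) `|a i| `^ p.
Proof.
move=> p0 a1; have [i ai|a0] := pickP (fun i => a i != 0).
  have aj j : j != i -> a j = 0.
    by move=> ji; apply/eqP; apply: contraNT ji => aj; apply/eqP; exact: a1.
  rewrite (bigD1 i)//= big1 ?addr0; last by move=> j /aj ->; rewrite expr0n.
  rewrite (bigD1 i)//= big1 ?addr0 ?sqr_powR// => j /aj ->.
  by rewrite normr0 powR0.
have {}a0 i : a i = 0 by have /negbFE/eqP := a0 i.
rewrite !big1 ?powR0// => [|i _|i _]; last by rewrite a0 expr0n.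
- by rewrite mulf_neq0// invr_eq0 pnatr_eq0.
- by rewrite a0 normr0 powR0.
Qed.

(* Only the last non-zero term matters, since the terms grow geometrically. *)
Lemma lacunary_lower p n (a : nat -> R) : 0 < p ->
  (forall k, a k = 0 \/ `|a k| `^ p = 2 ^+ k) ->
  \sum_(k < n) `|a k| `^ p <= 2 * (\sum_(k < n) a k ^+ 2) `^ (p / 2).
Proof.
move=> p0 aE; elim: n => [|n IH].
  by rewrite !big_ord0 mulr_ge0// powR_ge0.
(* A zero last term changes neither side. Otherwise the last term alone suffices: the left side is
   at most [1 + 2 + ... + 2 ^+ n], which is less than [2 * 2 ^+ n]. *)
have [an|an] := aE n.
  by rewrite !big_ord_recr/= an normr0 powR0 ?gt_eqF// expr0n !addr0.
have s0 : 0 <= \sum_(k < n) a k ^+ 2 by apply: sumr_ge0 => k _; exact: sqr_ge0.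
apply: (@le_trans _ _ (2 * `|a n| `^ p)).
  have : \sum_(k < n.+1) `|a k| `^ p <= \sum_(k < n.+1) 2 ^+ k.
    apply: ler_sum => k _; have [->|->//] := aE k.
    by rewrite normr0 powR0 ?gt_eqF// exprn_ge0.
  rewrite an -exprS; have := subrX1 (2 : R) n.+1.
  rewrite (_ : 2 - 1 = 1 :> R) ?mul1r; last by lra.
  by move=> <-; lra.
rewrite ler_pM2l// -sqr_powR ge0_ler_powR ?nnegrE ?sqr_ge0//.
- by rewrite divr_ge0 ?ltW.
- by rewrite big_ord_recr/= addr_ge0 ?sqr_ge0.
- by rewrite big_ord_recr/= lerDr.
Qed.

Lemma lacunary_upper p : 0 < p -> exists C : R, 0 < C /\
  forall n (a : nat -> R), (forall k, a k = 0 \/ `|a k| `^ p = 2 ^+ k) ->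
  (\sum_(k < n) a k ^+ 2) `^ (p / 2) <= C * \sum_(k < n) `|a k| `^ p.
Proof.
move=> p0; pose t : R := 2 `^ (2 / p).
have t1 : 1 < t.
  rewrite -[ltLHS](congr1 (fun f => f (2 / p)) (@powR1 R)) gt0_ltr_powR ?nnegrE//.
    by rewrite divr_gt0.
  by rewrite ltr1n.
have t0 : 0 < t by exact: lt_trans t1.
have tX k : t ^+ k = (2 ^+ k) `^ (2 / p).
  by rewrite /t -powR_mulrn ?powR_ge0// powRAC powR_mulrn.
(* The geometric sum up to [t ^+ n] is at most [t / (t - 1) * t ^+ n]; the constant is this factor
   raised to the power [p / 2]. *)
exists ((t / (t - 1)) `^ (p / 2)); split.
  by rewrite powR_gt0// divr_gt0// subr_gt0.
move=> n a aE; elim: n => [|n IH].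
  by rewrite !big_ord0 mulr0 powR0// mulf_neq0 ?invr_eq0 ?pnatr_eq0// gt_eqF.
have [an|an] := aE n.
  by rewrite !big_ord_recr/= an normr0 powR0 ?gt_eqF// expr0n !addr0.
have t10 : 0 < t - 1 by rewrite subr_gt0.
have sq_le : \sum_(k < n.+1) a k ^+ 2 <= t / (t - 1) * t ^+ n.
  apply: (@le_trans _ _ (\sum_(k < n.+1) t ^+ k)).
    apply: ler_sum => k _; have [->|ak] := aE k.
      by rewrite expr0n exprn_ge0// ltW.
    rewrite tX -ak -powRrM mulrC divfK ?gt_eqF//.
    by rewrite powR_mulrn// real_normK ?num_real.
  have := subrX1 t n.+1; rewrite mulrAC -exprS => E.
  by rewrite ler_pdivlMr// mulrC -E gerBl.
apply: (@le_trans _ _ ((t / (t - 1) * t ^+ n) `^ (p / 2))).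
  rewrite ge0_ler_powR ?nnegrE//.
  - by rewrite divr_ge0 ?ltW.
  - by apply: sumr_ge0 => k _; exact: sqr_ge0.
  - by rewrite mulr_ge0// ?(divr_ge0 (ltW t0) (ltW t10)) ?(exprn_ge0 _ (ltW t0)).
rewrite powRM ?(divr_ge0 (ltW t0) (ltW t10)) ?(exprn_ge0 _ (ltW t0))//.
rewrite ler_pM2l; last by rewrite powR_gt0// divr_gt0.
rewrite tX -powRrM (_ : 2 / p * (p / 2) = 1); last by field; rewrite gt_eqF.
rewrite powRr1 ?exprn_ge0// -an big_ord_recr/= lerDr.
by apply: sumr_ge0 => k _; exact: powR_ge0.
Qed.

Lemma powR_nat_bounded p (B : R) :
  (forall n, (0 < n)%N -> n%:R `^ p <= B) -> p <= 0.
Proof.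
move=> nB; rewrite leNgt; apply/negP => p0.
have B0 : 0 <= B by apply: le_trans (nB 1%N isT); exact: powR_ge0.
pose m := (Num.truncn (B `^ p^-1)).+1.
have Bm : B `^ p^-1 < m%:R by rewrite /m truncnS_gt.
have := nB m isT; rewrite leNgt => /negP; apply.
have -> : B = (B `^ p^-1) `^ p by rewrite -powRrM mulVf ?lt0r_neq0// powRr1.
by apply: gt0_ltr_powR; rewrite ?nnegrE ?powR_ge0 ?ler0n.
Qed.

End PowerSums.

(** * Families of martingale differences *)

Section Families.
Context {R : realType} (X : set R) (root : R -> R * R).
Hypothesis rootP : partition_map X root.
Context (o : R).
Hypothesis Xo : X o.
Local Notation mu := (@lebesgue_measure R).
Local Notation length := (length root).
Local Notation index := (index root).
Local Notation piece := (piece X root).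
Local Notation cell := (cell X root).
Local Notation step := (step X root o).
Local Notation L := (cell_lattice rootP).

Lemma Hnorm_steps p n (Phi : nat -> nat -> R) :
  (forall k, (k < n)%N -> balanced k (Phi k)) ->
  Hnorm L p (fun y => (\sum_(k < n) step (depth k.+1) (Phi k) y)%:C%C) =
  fine (\int[mu]_y
    ((\sum_(k < n) step (depth k.+1) (Phi k) y ^+ 2) `^ (p / 2))%:E) `^ p^-1.
Proof.
move=> bal; rewrite /Hnorm unlock fine_poweR; congr (fine _ `^ _).
apply: eq_integral => y _; rewrite (square_function_steps rootP Xo)//=.
by rewrite ger0_norm ?powR_ge0// -powRrM mulrC.
Qed.

Lemma integral_steps n (D : nat -> nat) (g : nat -> nat -> R) :
  (\int[mu]_y (\sum_(k < n) step (D k) (g k) y)%:E =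
  (\sum_(k < n) length o / 2 ^+ D k * \sum_(j < 2 ^ D k) g k j)%:E)%E.
Proof.
under eq_integral do rewrite -sumEFin.
rewrite integral_sum//; last by move=> k; exact: integrable_step.
by rewrite -sumEFin; apply: eq_bigr => k _; rewrite integral_stepT.
Qed.

Lemma step_map (f : R -> R) D Phi y :
  f 0 = 0 -> f (step D Phi y) = step D (fun j => f (Phi j)) y.
Proof. by move=> f0; rewrite /step; case: asboolP. Qed.

Context (psi : nat -> nat -> R).

(** The remainder modulo [2 ^ k.+1] is the position of a piece among its siblings, so every cell of
    generation [k] carries the same profile [psi k]. *)
Definition periodic (k j : nat) : R := psi k (j %% 2 ^ k.+1).

(** The mask compares sets because the family is indexed by members of the lattice, whose generation
    is not part of the data. *)
Definition masked (J : set R) (k j : nat) : R :=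
  if `[< piece (depth k) o (j %/ 2 ^ k.+1) = J >] then periodic k j else 0.

Lemma step_masked J k y : step (depth k.+1) (masked J k) y =
  if `[< cell (depth k) y = J >] then step (depth k.+1) (periodic k) y else 0.
Proof.
have [[Xy ry]|out] := pselect (X y /\ root y = root o); last first.
  by rewrite !step_out// if_same.
rewrite !step_in// /masked depthS -(index_divn rootP (depth k) k.+1 Xy).
by rewrite /cell /piece ry.
Qed.

Lemma masked_block (f : R -> R) J k : f 0 = 0 ->
  \sum_(j < 2 ^ depth k.+1) f (masked J k j) =
  \sum_(q < 2 ^ depth k)
    if `[< piece (depth k) o q = J >] then \sum_(r < 2 ^ k.+1) f (psi k r) else 0.
Proof.
move=> f0; rewrite depthS expnD.
have n0 : (0 < 2 ^ k.+1)%N by rewrite expn_gt0.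
rewrite (sum_blocks (2 ^ depth k) xpredT (fun j => f (masked J k j)) n0).
apply: eq_bigr => q _; rewrite /masked /periodic.
under eq_bigr => r _ do rewrite divnMDl// divn_small// addn0 modnMDl modn_small//.
by case: asboolP => // _; rewrite big1.
Qed.

Lemma periodic_block (f : R -> R) k :
  \sum_(j < 2 ^ depth k.+1) f (periodic k j) =
  (2 ^ depth k)%:R * \sum_(r < 2 ^ k.+1) f (psi k r).
Proof.
rewrite depthS expnD.
have n0 : (0 < 2 ^ k.+1)%N by rewrite expn_gt0.
rewrite (sum_blocks (2 ^ depth k) xpredT (fun j => f (periodic k j)) n0).
rewrite mulr_natl -[X in _ *+ X]card_ord -sumr_const.
apply: eq_bigr => q _; apply: eq_bigr => r _.
by rewrite /periodic modnMDl modn_small.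
Qed.

Hypothesis psi0 : forall k, \sum_(r < 2 ^ k.+1) psi k r = 0.

Lemma periodic_balanced k : balanced k (periodic k).
Proof.
move=> q _; rewrite -[RHS](psi0 k); apply: eq_bigr => r _.
by rewrite /periodic modnMDl modn_small.
Qed.

Lemma masked_balanced J k : balanced k (masked J k).
Proof.
move=> q qk; have := periodic_balanced qk; rewrite /masked.
under [X in _ -> X = _]eq_bigr => r _ do rewrite divnMDl ?expn_gt0// divn_small// addn0.
by case: asboolP => // _ _; rewrite big1.
Qed.

(* The part of [h_0 + ... + h_(n-1)] carried by the cell [J], where [h_k] has the
   values [psi k] on the children of each cell of generation [k]; it vanishes when
   [J] is not a cell of the interval of [o] of generation less than [n]. *)
Definition atom (n : nat) (J : set R) : R -> R[i]^o :=
  fun y => (\sum_(k < n) step (depth k.+1) (masked J k) y)%:C%C.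

Lemma atom_cell n m x y : X x -> atom n (cell (depth m) x) y =
  (step (depth m.+1)
    (fun j => if (m < n)%N then masked (cell (depth m) x) m j else 0) y)%:C%C.
Proof.
move=> Xx; congr (_%:C)%C.
have ne k : k != m -> step (depth k.+1) (masked (cell (depth m) x) k) y = 0.
  move=> km; rewrite step_masked; case: asboolP => // E.
  have [[Xy ry]|out] := pselect (X y /\ root y = root o); last by rewrite step_out.
  by move: km; rewrite (depth_inj (cell_level rootP Xy Xx E)) eqxx.
case: ltnP => [mn|nm].
  rewrite (bigD1 (Ordinal mn))//= big1 ?addr0// => k km; apply: ne.
  by apply: contraNneq km => E; apply/eqP/val_inj.
rewrite big1 => [|k _]; first by rewrite /step if_same.
by apply: ne; rewrite neq_ltn (leq_trans _ nm).
Qed.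

Lemma admissible_step D Phi : admissible L (fun y => (step D Phi y)%:C%C).
Proof.
split=> /=; [exact: measurable_step|exact: measurable_cst|].
move=> I LI _ x y Ix Iy; have [z Xz E] := LI (Posz D).
(* Since [D <= depth D], generation [D] is already fine enough for the function to be constant on
   its cells. *)
have DD : (D <= depth D)%N.
  by elim: (D) => // d IH; rewrite depthS addnS ltnS (leq_trans IH)// leq_addr.
have zx : cell (depth D) z x by rewrite [cell _ _]E; exact: Ix.
have zy : cell (depth D) z y by rewrite [cell _ _]E; exact: Iy.
congr (_%:C)%C.
by rewrite (step_cell rootP o Phi Xz DD zx) (step_cell rootP o Phi Xz DD zy).
Qed.

Lemma Lp_space_step p D Phi : p != 0 ->
  Lp_space L p (fun y => (step D Phi y)%:C%C).
Proof.
move=> p0; split; first exact: admissible_step.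
rewrite unlock poweR_lty// (_ : integral _ _ _ =
  (\int[mu]_y (step D (fun j => `|Phi j| `^ p) y)%:E)%E).
  by rewrite integral_stepT// ltry.
apply: eq_integral => y _; rewrite patchE /step.
case: asboolP => [[Xy ry]|out].
  by rewrite mem_set//= expr0n /= addr0 sqrtr_sqr normr_id.
by case: ifP => _ /=; rewrite ?expr0n /= ?addr0 ?sqrtr0 normr0 powR0.
Qed.

(** The atom is a step function in [L^2] fixed by the difference operator of [J], so it is its own
    preimage. *)
Lemma atom_mdiff n (J : branching L) : mdiff_space J (atom n (val J)).
Proof.
have [Jm _] := set_valP J; have [m [x [Xx E]]] := (members_cell rootP _).1 Jm.
exists (atom n (val J)).
  rewrite E (_ : atom _ _ = fun y => (step (depth m.+1)
    (fun j => if (m < n)%N then masked (cell (depth m) x) m j else 0) y)%:C%C).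
    exact: Lp_space_step.
  by apply/funext => y; exact: atom_cell.
rewrite E; apply/funext => y; rewrite atom_cell// /atom mdiff_steps//; last first.
  by move=> k _; exact: masked_balanced.
congr (_%:C)%C; case: ifPn => [/andP[_ ->]//|].
case: ltnP => [mn|_ _]; last by rewrite /step if_same.
rewrite andbT => /asboolP xy; rewrite step_masked; case: asboolP => // yx.
have [[Xy ry]|out] := pselect (X y /\ root y = root o); last by rewrite step_out.
by case: xy; rewrite -yx; exact: cell_mem.
Qed.

(** At each point at most one generation contributes, so the norm depends on [psi] only through the
    sums of [|psi k r|^p]. Profiles with equal sums give atoms of equal norm. *)
Lemma atom_norm p n J : 0 < p -> Hnorm L p (atom n J) =
  (\sum_(k < n) length o / 2 ^+ depth k.+1 * \sum_(q < 2 ^ depth k)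
    if `[< piece (depth k) o q = J >] then \sum_(r < 2 ^ k.+1) `|psi k r| `^ p else 0)
  `^ p^-1.
Proof.
move=> p0; rewrite /atom Hnorm_steps; last by move=> k _; exact: masked_balanced.
congr (_ `^ _).
rewrite (_ : integral _ _ _ = (\int[mu]_y (\sum_(k < n)
    step (depth k.+1) (fun j => `|masked J k j| `^ p) y)%:E)%E).
  rewrite (integral_steps n (fun k => depth k.+1) (fun k j => `|masked J k j| `^ p))/=.
  apply: eq_bigr => k _; congr (_ * _).
  by rewrite (masked_block (f := fun t => `|t| `^ p))// normr0 powR0// gt_eqF.
apply: eq_integral => y _; congr EFin.
rewrite (powR_sum_sqr1 (a := fun k : 'I_n => step (depth k.+1) (masked J k) y)).
- apply: eq_bigr => k _; apply: (step_map (f := fun t => `|t| `^ p)).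
  by rewrite normr0 powR0// gt_eqF.
- by rewrite gt_eqF.
- have nz (k : 'I_n) : step (depth k.+1) (masked J k) y != 0 -> X y /\ cell (depth k) y = J.
    move=> k0; split.
      have [[]//|out] := pselect (X y /\ root y = root o).
      by move: k0; rewrite step_out ?eqxx.
    by move: k0; rewrite step_masked; case: asboolP => //; rewrite eqxx.
  move=> i j /nz[Xy iJ] /nz[_ jJ].
  by apply/val_inj/depth_inj/(cell_level rootP Xy Xy); rewrite iJ.
Qed.

(** [cell 0 o] is the whole initial interval of [o], so this finite set contains every index of a
    non-zero atom. *)
Definition atom_support n : set (branching L) :=
  [set J | (\bigcup_(k < n) (cell (depth k) @` cell 0 o)) (val J)].

Lemma finite_atom_support n : finite_set (atom_support n).
Proof.
apply: (@finite_preimage _ _ _ val); first by move=> I J _ _; exact: val_inj.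
by apply: bigcup_finite => // k _; exact: finite_cells.
Qed.

Lemma cell0P y : X y -> root y = root o -> cell 0 o y.
Proof.
move=> Xy ry; split=> //; have := index_lt rootP 0 Xo; have := index_lt rootP 0 Xy.
by rewrite expn0 !ltnS !leqn0 => /eqP-> /eqP->.
Qed.

Lemma atom_out n J : ~ atom_support n J -> atom n (val J) = 0.
Proof.
move=> nJ; apply/funext => y; rewrite /atom big1// => k _.
rewrite step_masked; case: asboolP => // E.
have [[Xy ry]|out] := pselect (X y /\ root y = root o); last by rewrite step_out.
by case: nJ; exists k => //=; exists y => //; exact: cell0P.
Qed.

Lemma atom_finite n : finite_family (@mdiff_space _ _ L) (fun J => atom n (val J)).
Proof.
split=> [J|]; first exact: atom_mdiff.
apply: sub_finite_set (finite_atom_support n) => J /= J0.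
by apply: contrapT => /atom_out E; move: J0; rewrite E eqxx.
Qed.

(** At a point of the interval of [o], exactly one mask of each generation is active, that of the
    cell containing the point. *)
Lemma atom_sum n : \sum_(J \in [set: branching L]) atom n (val J) =
  fun y => (\sum_(k < n) step (depth k.+1) (periodic k) y)%:C%C.
Proof.
have fS := finite_atom_support n.
rewrite -(fsbig_widen (atom_support n))//; last by move=> J [_ /atom_out].
apply/funext => y; rewrite fsbig_fct// fsbig_finite// -rmorph_sum; congr (_%:C)%C.
rewrite exchange_big; apply: eq_bigr => k _ /=.
under eq_bigr do rewrite step_masked.
have [[Xy ry]|out] := pselect (X y /\ root y = root o); last first.
  by rewrite step_out// big1// => J _; rewrite if_same.
pose Jk : branching L := exist _ (cell (depth k) y) (mem_set (branching_cell rootP _ Xy)).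
rewrite -fsbig_finite// -(fsbig_widen [set Jk]).
- by rewrite fsbig_set1 asboolT.
- by move=> _ ->; exists k => //=; exists y => //; exact: cell0P.
- move=> J [_ /= JJk]; case: asboolP => // E; case: JJk; apply/val_inj.
  by rewrite /= E.
Qed.

Lemma atom_sum_norm p n : Hnorm L p (\sum_(J \in [set: branching L]) atom n (val J)) =
  fine (\int[mu]_y
    ((\sum_(k < n) step (depth k.+1) (periodic k) y ^+ 2) `^ (p / 2))%:E) `^ p^-1.
Proof. by rewrite atom_sum Hnorm_steps// => k _; exact: periodic_balanced. Qed.

Lemma integral_powers p n : 0 < p ->
  (\int[mu]_y (\sum_(k < n) `|step (depth k.+1) (periodic k) y| `^ p)%:E =
   (\sum_(k < n) length o / 2 ^+ k.+1 * \sum_(r < 2 ^ k.+1) `|psi k r| `^ p)%:E)%E.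
Proof.
move=> p0; rewrite (_ : integral _ _ _ = (\int[mu]_y (\sum_(k < n)
    step (depth k.+1) (fun j => `|periodic k j| `^ p) y)%:E)%E).
  rewrite (integral_steps n (fun k => depth k.+1) (fun k j => `|periodic k j| `^ p))/=.
  congr EFin; apply: eq_bigr => k _.
  rewrite (periodic_block (fun t => `|t| `^ p)) depthS exprD natrX.
  by field; rewrite !expf_neq0.
apply: eq_integral => y _; congr EFin; apply: eq_bigr => k _.
by apply: (step_map (f := fun t => `|t| `^ p)); rewrite normr0 powR0// gt_eqF.
Qed.

End Families.

(** * Integrated bounds for the square function of a sum *)

Section Energy.
Context {R : realType} (X : set R) (root : R -> R * R).
Hypothesis rootP : partition_map X root.
Context (o : R).
Hypothesis Xo : X o.
Local Notation mu := (@lebesgue_measure R).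
Context (p : R) (psi : nat -> nat -> R).
Hypothesis p0 : 0 < p.
Hypothesis psip : forall k, \sum_(r < 2 ^ k.+1) `|psi k r| `^ p = 2 ^+ k.+1.

(** With the normalization [psip], each generation contributes exactly [length root o] to the
    integral of the [p]-th powers; the pointwise bounds are then integrated. *)
Lemma energy_bounds n (c1 c2 : R)
    (a := fun k => step X root o (depth k.+1) (periodic psi k)) :
  0 <= c1 -> 0 <= c2 ->
  (forall y, c1 * (\sum_(k < n) `|a k y| `^ p) <= (\sum_(k < n) a k y ^+ 2) `^ (p / 2)
             <= c2 * (\sum_(k < n) `|a k y| `^ p)) ->
  c1 * (n%:R * length root o) <=
    fine (\int[mu]_y ((\sum_(k < n) a k y ^+ 2) `^ (p / 2))%:E) <=
  c2 * (n%:R * length root o).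
Proof.
move=> c10 c20 ac.
have ma k : measurable_fun setT (a k) by exact: measurable_step.
have T0 y : 0 <= \sum_(k < n) `|a k y| `^ p by apply: sumr_ge0 => k _; exact: powR_ge0.
have mT : measurable_fun setT (fun y => \sum_(k < n) `|a k y| `^ p).
  apply: measurable_sum => k; apply: (measurableT_comp (measurable_powR p)).
  exact: measurableT_comp.
have mS : measurable_fun setT (fun y => (\sum_(k < n) a k y ^+ 2) `^ (p / 2)).
  apply: (measurableT_comp (measurable_powR (p / 2))).
  by apply: measurable_sum => k; exact: measurable_funX.
have intT c : 0 <= c -> (\int[mu]_y (c * (\sum_(k < n) `|a k y| `^ p))%:E =
    (c * (n%:R * length root o))%:E)%E.
  move=> c0; under eq_integral do rewrite EFinM.
  rewrite ge0_integralZl_EFin//; first last.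
  - exact/measurable_EFinP.
  - by move=> y _; rewrite lee_fin.
  rewrite integral_powers// -EFinM; congr (_ * _)%:E.
  under eq_bigr do rewrite psip divfK ?expf_neq0//.
  by rewrite sumr_const card_ord mulr_natl.
have lower : ((c1 * (n%:R * length root o))%:E <=
    \int[mu]_y ((\sum_(k < n) a k y ^+ 2) `^ (p / 2))%:E)%E.
  rewrite -intT//; apply: ge0_le_integral => //.
  - by move=> y _; rewrite lee_fin mulr_ge0.
  - by apply/measurable_EFinP; exact: measurable_funM.
  - exact/measurable_EFinP.
  - by move=> y _; rewrite lee_fin; have /andP[] := ac y.
have upper : (\int[mu]_y ((\sum_(k < n) a k y ^+ 2) `^ (p / 2))%:E <=
    (c2 * (n%:R * length root o))%:E)%E.
  rewrite -intT//; apply: ge0_le_integral => //.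
  - by move=> y _; rewrite lee_fin powR_ge0.
  - exact/measurable_EFinP.
  - by apply/measurable_EFinP; exact: measurable_funM.
  - by move=> y _; rewrite lee_fin; have /andP[] := ac y.
(* Finiteness is what allows passing through [fine], which sends an infinite integral to zero. *)
have fin : (\int[mu]_y ((\sum_(k < n) a k y ^+ 2) `^ (p / 2))%:E)%E \is a fin_num.
  rewrite ge0_fin_numE; first exact: le_lt_trans upper (ltry _).
  by apply: integral_ge0 => y _; rewrite lee_fin powR_ge0.
by rewrite -!lee_fin fineK// lower upper.
Qed.

End Energy.

(** * The flat and the concentrated profiles *)

Section Profiles.
Context {R : realType}.
Implicit Types (c : nat -> nat -> R).

(** Each value of [c] is placed with opposite signs on two neighbouring children, which forces mean
    zero. *)
Definition alternating c (k r : nat) : R := c k r./2 * (-1) ^+ r.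

Lemma alternating_sum c k (f : R -> R) :
  \sum_(r < 2 ^ k.+1) f (alternating c k r) =
  \sum_(q < 2 ^ k) (f (c k q) + f (- c k q)).
Proof.
rewrite expnSr (sum_blocks (2 ^ k) xpredT (fun r => f (alternating c k r)))//.
apply: eq_bigr => q _; rewrite /alternating.
under eq_bigr => r _.
  rewrite -divn2 divnMDl// divn_small// addn0 exprD mulnC exprM sqrrN !expr1n mul1r.
  over.
by rewrite !big_ord_recl big_ord0 addr0 /= expr0 expr1 mulr1 mulrN1.
Qed.

Lemma alternating_sum0 c k : \sum_(r < 2 ^ k.+1) alternating c k r = 0.
Proof.
by rewrite (alternating_sum c k id) big1// => q _; rewrite subrr.
Qed.

Definition flat (k q : nat) : R := 1.

(** The height is chosen so that the two non-zero children contribute [2 * 2 ^+ k] to the sum of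
    [p]-th powers, the same total as for [flat]. *)
Definition spike (p : R) (k q : nat) : R := if q == 0%N then (2 ^+ k) `^ p^-1 else 0.

Lemma flat_sum p k : \sum_(r < 2 ^ k.+1) `|alternating flat k r| `^ p = 2 ^+ k.+1.
Proof.
rewrite (alternating_sum flat k (fun t => `|t| `^ p)) /flat normrN normr1 powR1.
by rewrite sumr_const card_ord exprS -[LHS]mulr_natr natrX.
Qed.

Lemma spike_powR p k : 0 < p -> `|(2 ^+ k) `^ p^-1| `^ p = 2 ^+ k :> R.
Proof.
move=> p0; rewrite ger0_norm ?powR_ge0// -powRrM mulVf ?gt_eqF//.
by rewrite powRr1// exprn_ge0.
Qed.

Lemma spike_sum p k : 0 < p ->
  \sum_(r < 2 ^ k.+1) `|alternating (spike p) k r| `^ p = 2 ^+ k.+1.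
Proof.
move=> p0; rewrite (alternating_sum (spike p) k (fun t => `|t| `^ p)).
have k0 : (0 < 2 ^ k)%N by rewrite expn_gt0.
rewrite (bigD1 (Ordinal k0))//= big1 ?addr0 => [|q q0].
  by rewrite normrN spike_powR// exprS mulr2n mulrDl mul1r.
rewrite /spike ifF; last by apply/negbTE; rewrite -val_eqE in q0.
by rewrite oppr0 normr0 powR0 ?addr0// gt_eqF.
Qed.

Lemma alternating_norm c k r : `|alternating c k r| = `|c k r./2|.
Proof. by rewrite /alternating normrM normrX normrN1 expr1n mulr1. Qed.

End Profiles.

(** * Comparison of norms in a strong unconditional basis, and the contradiction *)

Lemma basis_compare (R : realType) (J : choiceType) (V : lmodType R[i])
    (H : set V) (nrm : V -> R) (E : J -> set V) :
  strong_unconditional_basis H nrm E ->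
  exists2 A : R, 0 < A & forall x x', finite_family E x -> finite_family E x' ->
    (forall j, nrm (x j) = nrm (x' j)) ->
    nrm (\sum_(j \in [set: J]) x j) <= A * nrm (\sum_(j \in [set: J]) x' j).
Proof.
move=> [_ [Y [coef [A [[coef_inj _] A0 sandwich]]]]].
exists (A ^+ 2) => [|x x' Ex Ex' xx']; first exact: exprn_gt0.
have [y [yE lower _]] := sandwich x Ex.
have [y' [yE' _ upper]] := sandwich x' Ex'.
(* Equal norm sequences come from one vector of [Y], so both sums are comparable with its norm, at
   the cost of [A ^+ 2]. *)
have yy : y = y'.
  by apply: coef_inj; rewrite yE yE'; apply/funext => j; rewrite xx'.
move: lower; rewrite yy => /le_trans /(_ upper).
by rewrite lecR ler_pdivrMl// mulrA expr2.
Qed.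

Theorem proposition4p2 (R : realType) (p : R) (p_ge1 : 1 <= p) (p_neq2 : p != 2)
    (X : set R) (X_itv : base_interval X) :
  exists L : lattice X,
    ~ strong_unconditional_basis (Hspace L p) (Hnorm L p)
        (fun I : branching L => mdiff_space I).
Proof.
have p0 : 0 < p by exact: lt_le_trans p_ge1.
have [root rootP] := exists_partition_map X_itv.
have [_ [ o Xo] _] := X_itv.
exists (cell_lattice rootP) => /basis_compare[A A0 compare_norms].
have l0 := length_gt0 rootP Xo.
pose psi1 := alternating (@flat R); pose psi2 := alternating (spike p).
(* [E psi n] is the [p]-th power of the norm of the sum of the atoms of profile [psi]. *)
pose E psi n := fine (\int[lebesgue_measure]_y
  ((\sum_(k < n) step X root o (depth k.+1) (periodic psi k) y ^+ 2) `^ (p / 2))%:E).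
have compare (psi psi' : nat -> nat -> R) n :
    (forall k, \sum_(r < 2 ^ k.+1) psi k r = 0) ->
    (forall k, \sum_(r < 2 ^ k.+1) psi' k r = 0) ->
    (forall k, \sum_(r < 2 ^ k.+1) `|psi k r| `^ p = 2 ^+ k.+1) ->
    (forall k, \sum_(r < 2 ^ k.+1) `|psi' k r| `^ p = 2 ^+ k.+1) ->
    E psi n <= A `^ p * E psi' n.
  move=> psi0 psi0' psip psip'.
  have E0 ps : 0 <= E ps n.
    by apply: fine_ge0; apply: integral_ge0 => y _; rewrite lee_fin powR_ge0.
  have norm_le := compare_norms _ _ (atom_finite rootP Xo psi0 n)
    (atom_finite rootP Xo psi0' n).
  rewrite (atom_sum_norm rootP Xo psi0) (atom_sum_norm rootP Xo psi0') in norm_le.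
  have {}norm_le : E psi n `^ p^-1 <= A * E psi' n `^ p^-1.
    apply: norm_le => J; rewrite (atom_norm rootP Xo psi0 _ _ p0).
    rewrite (atom_norm rootP Xo psi0' _ _ p0); congr (_ `^ _).
    by apply: eq_bigr => k _; rewrite psip psip'.
  have rootK a : 0 <= a -> (a `^ p^-1) `^ p = a.
    by move=> a0; rewrite -powRrM mulVf ?lt0r_neq0// powRr1.
  rewrite -(rootK (E psi n))// -(rootK (E psi' n))//.
  rewrite -powRM ?powR_ge0 ?(ltW A0)//.
  by apply: ge0_ler_powR => //; rewrite ?ltW ?nnegrE ?mulr_ge0 ?powR_ge0 ?(ltW A0).
(* For the flat profile the sum of squares and the sum of [p]-th powers both equal [n] on the
   interval of [o], so [energy_bounds] applies with [c1 = c2]. *)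
have E1 n : (0 < n)%N -> E psi1 n = n%:R `^ (p / 2 - 1) * (n%:R * length root o).
  move=> n0; apply/eqP; rewrite eq_le andbC.
  apply: (energy_bounds rootP Xo p0) => [k| | |y]; rewrite ?powR_ge0//.
    exact: flat_sum.
  have [[Xy ry]|out] := pselect (X y /\ root y = root o); last first.
    rewrite !big1 ?powR0 ?mulr0 ?lexx// => [|k _|k _].
    - by rewrite mulf_neq0 ?lt0r_neq0// invr_gt0.
    - by rewrite step_out// expr0n.
    - by rewrite step_out// normr0 powR0// lt0r_neq0.
  have a1 k : `|step X root o (depth k.+1) (periodic psi1 k) y| = 1.
    by rewrite step_in// /periodic alternating_norm normr1.
  have -> : \sum_(k < n) `|step X root o (depth k.+1) (periodic psi1 k) y| `^ p = n%:R.
    by under eq_bigr do rewrite a1 powR1; rewrite sumr_const card_ord.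
  have -> : \sum_(k < n) step X root o (depth k.+1) (periodic psi1 k) y ^+ 2 = n%:R.
    under eq_bigr do rewrite -real_normK ?num_real// a1 expr1n.
    by rewrite sumr_const card_ord.
  have -> : n%:R `^ (p / 2) = n%:R `^ (p / 2 - 1) * n%:R :> R.
    rewrite -{3}(powRr1 (ler0n R n)).
    by rewrite -powRD ?pnatr_eq0 -?lt0n ?n0 ?implybT// subrK.
  by rewrite lexx.
have [C [C0 upper]] := lacunary_upper p0.
have E2 n : 2^-1 * (n%:R * length root o) <= E psi2 n <= C * (n%:R * length root o).
  apply: (energy_bounds rootP Xo p0) => [k| | |y]; rewrite ?invr_ge0 ?(ltW C0)//.
    exact: spike_sum.
  pose a k := step X root o (depth k.+1) (periodic psi2 k) y.
  have a1 k : a k = 0 \/ `|a k| `^ p = 2 ^+ k.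
    rewrite /a /step; case: asboolP => _; last by left.
    rewrite alternating_norm /periodic /psi2 /alternating /spike.
    by case: eqP => _; [right; rewrite spike_powR|left; rewrite mul0r].
  apply/andP; split; last exact: upper n a a1.
  by rewrite ler_pdivrMl//; exact: (lacunary_lower n p0 a1).
have B0 : 0 < A `^ p by rewrite powR_gt0.
have le2 : p / 2 - 1 <= 0.
  apply: (@powR_nat_bounded _ _ (A `^ p * C)) => n n0.
  have nl0 : 0 < n%:R * length root o by rewrite mulr_gt0// ltr0n.
  rewrite -(ler_pM2r nl0) -E1// -mulrA.
  apply: le_trans (compare psi1 psi2 n _ _ _ _) _ => [k|k|k|k|].
  - exact: alternating_sum0.
  - exact: alternating_sum0.
  - exact: flat_sum.
  - exact: spike_sum.
  by rewrite ler_pM2l//; have /andP[] := E2 n.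
have ge2 : 1 - p / 2 <= 0.
  apply: (@powR_nat_bounded _ _ (2 * A `^ p)) => n n0.
  have nl0 : 0 < n%:R * length root o by rewrite mulr_gt0// ltr0n.
  have np0 : 0 < n%:R `^ (p / 2 - 1) by rewrite powR_gt0// ltr0n.
  rewrite -opprB powRN -div1r ler_pdivrMr// -(ler_pM2r nl0) mul1r -!mulrA -E1//.
  rewrite -ler_pdivrMl//; have /andP[/le_trans + _] := E2 n; apply.
  apply: (compare psi2 psi1) => k.
  - exact: alternating_sum0.
  - exact: alternating_sum0.
  - exact: spike_sum.
  - exact: flat_sum.
by move/eqP: p_neq2; apply; lra.
Qed.
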